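(* For a distributed storage system with parameters $(\alpha,\beta,N,k,d,T)$ and lifetime bound $L$ as described in the context, the storage capacity $C$ satisfies $$C \ \ge\ \min\left\{\ \sum_{i=0}^{k-F(T)-1}\min\{(d-F(T)-i)\beta,\ \alpha\},\ \ (d-T)\beta\right\},$$ where $F(T) = T+\lfloor T^2/4\rfloor+1$ (an empty sum being $0$).
   Context: Alphabet $\mathcal{X}=[K]$. A distributed storage system has $N$ active storage nodes at any time; each node stores an element of $\mathcal{X}^{n\alpha}$ (storage capacity $\alpha$), where $n$ is a blocklength and $\alpha\ge\beta>0$ are rationals with $n\alpha,n\beta$ integers. Nodes may fail; when a node fails a new node is created, which contacts $d$ existing nodes, each of which sends it a message in $\mathcal{X}^{n\beta}$ computed from its stored content; the new node computes its stored content from the received messages (functional repair). A data collector may at any time contact any $k\le d$ existing nodes, download their stored contents, and must reconstruct the file. The evolution (which nodes fail, which nodes are contacted for repair, when and from which nodes data collectors download) is arbitrary and unknown in advance, except that the total number of storage nodes over the lifetime is at most a known finite $L$. An omniscient adversary (knowing the file and the code) may control up to $T$ nodes at any given moment (possibly different nodes over time) and may replace every message sent by a controlled node (repair transmissions and data-collector downloads) with arbitrary messages; honest nodes follow the code. A rate $R$ is achievable if for some $n$ there is a code such that every file $f\in\mathcal{X}^{nR}$ is always reconstructed without error, for every evolution and every adversary behavior. The storage capacity $C$ is the supremum of achievable rates. *)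

(* Defs.v *)
From HB Require Import structures.
From mathcomp Require Import all_boot all_order all_algebra.
Set Implicit Arguments. Unset Strict Implicit. Unset Printing Implicit Defensive.
Import Order.TTheory GRing.Theory Num.Theory.

(* Node identifiers are natural numbers.  The initial nodes are 0, ..., N-1,
   and the j-th newly created node (j = 0, 1, ...) gets identifier N + j. *)

(* Events of an evolution:
   - [Repair fl hs] : active node [fl] fails; a new node is created which
     contacts the (distinct) helper nodes [hs];
   - [Collect s]    : a data collector downloads from the (distinct) nodes [s]. *)
Inductive event : Type :=
  | Repair of nat & seq nat
  | Collect of seq nat.

(* Validity of an evolution, given the current list of active nodes [act]
   and the identifier [nxt] that the next created node will receive.
   A new node must satisfy [nxt < L]: at most L nodes over the lifetime. *)
Fixpoint valid_from (k d L : nat) (act : seq nat) (nxt : nat) (evs : seq event)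
  : bool :=
  match evs with
  | [::] => true
  | Repair fl hs :: r =>
      [&& fl \in act, uniq hs, size hs == d,
          all (fun h => (h \in act) && (h != fl)) hs,
          nxt < L & valid_from k d L (nxt :: rem fl act) nxt.+1 r]
  | Collect s :: r =>
      [&& uniq s, size s == k, all (fun h => h \in act) s &
          valid_from k d L act nxt r]
  end.

Definition valid_evolution (N k d L : nat) (evs : seq event) : bool :=
  valid_from k d L (iota 0 N) N evs.

(* Alphabet X = 'I_K.  Stored contents are in X^a (a = n alpha), repair
   messages in X^b (b = n beta), files in X^m (m = n R).
   The code functions may depend on the node identity and on the evolution
   history so far (the list of events, the current one last). *)
Record code (K a b m : nat) : Type := Code {
  c_enc : nat -> m.-tuple 'I_K -> a.-tuple 'I_K;
  c_msg : seq event -> nat -> a.-tuple 'I_K -> b.-tuple 'I_K;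
      (* repair message sent by helper node h, from its stored content *)
  c_reg : seq event -> seq (b.-tuple 'I_K) -> a.-tuple 'I_K;
      (* content of the new node from the received messages (helper order) *)
  c_dec : seq event -> seq (a.-tuple 'I_K) -> m.-tuple 'I_K
}.

(* Adversary behaviour, indexed by the step t of the evolution:
   [adv_ctrl t] is the set of nodes controlled at step t, and
   [adv_msg t h], [adv_dl t h] are the messages that a controlled node h
   sends instead of the honest ones (repair message / download). *)
Record adversary (K a b : nat) : Type := Adversary {
  adv_ctrl : nat -> seq nat;
  adv_msg : nat -> nat -> b.-tuple 'I_K;
  adv_dl : nat -> nat -> a.-tuple 'I_K
}.

Definition adversary_ok (T : nat) K a b (adv : adversary K a b) : Prop :=
  forall t, size (undup (adv_ctrl adv t)) <= T.

(* Running the system: [st] gives the stored content of each node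
   (only meaningful on active nodes), [nxt] the next node identifier,
   [t] the step index, [hist] the past events.  The proposition states that
   every data collector in the remaining evolution outputs the file [f]. *)
Fixpoint run_correct K a b m (cd : code K a b m) (f : m.-tuple 'I_K)
  (adv : adversary K a b) (hist : seq event) (st : nat -> a.-tuple 'I_K)
  (nxt t : nat) (evs : seq event) : Prop :=
  match evs with
  | [::] => True
  | e :: r =>
      let h := rcons hist e in
      let C := adv_ctrl adv t in
      match e with
      | Repair fl hs =>
          let ms := map (fun j => if j \in C then adv_msg adv t j
                                  else c_msg cd h j (st j)) hs in
          let c := c_reg cd h ms in
          run_correct cd f adv h (fun j => if j == nxt then c else st j)
                      nxt.+1 t.+1 r
      | Collect s =>
          let ds := map (fun j => if j \in C then adv_dl adv t j else st j) s in
          c_dec cd h ds = f /\ run_correct cd f adv h st nxt t.+1 r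
      end
  end.

Definition code_correct (N k d T L : nat) K a b m (cd : code K a b m) : Prop :=
  forall (f : m.-tuple 'I_K) (evs : seq event),
    valid_evolution N k d L evs ->
    forall adv : adversary K a b, adversary_ok T adv ->
      run_correct cd f adv [::] (fun i => c_enc cd i f) N 0 evs.

Local Open Scope ring_scope.

Definition achievable (K N k d T L : nat) (alpha beta R : rat) : Prop :=
  exists n a b m : nat,
    [/\ (0 < n)%N, n%:R * alpha = a%:R, n%:R * beta = b%:R,
        n%:R * R = m%:R &
        exists cd : code K a b m, code_correct N k d T L cd].

(* "C >= x", where C is the supremum of the achievable rates. *)
Definition capacity_ge (K N k d T L : nat) (alpha beta x : rat) : Prop :=
  forall r : rat, r < x -> exists R, achievable K N k d T L alpha beta R /\ r <= R.

Definition FT (T : nat) : nat := (T + (T * T) %/ 4 + 1)%N.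

Definition lower_bound (k d T : nat) (alpha beta : rat) : rat :=
  Num.min (\sum_(0 <= i < k - FT T)
             Num.min ((d%:R - (FT T)%:R - i%:R) * beta) alpha)
          ((d%:R - T%:R) * beta).

(* Main.v *)
Require Import Defs.
From HB Require Import structures.
From mathcomp Require Import all_boot all_order all_algebra zify ring.
Import Order.TTheory GRing.Theory Num.Theory.
Set Implicit Arguments. Unset Strict Implicit. Unset Printing Implicit Defensive.

(** A file is an integer matrix X, of m rows and l long columns, taken among the
    matrices having one prescribed Gram matrix; fixing it costs a vanishing part
    of the rate.  Nodes store and send products C X with bounded integer matrices
    C chosen generically, together with the _version_ that determines C, namely
    the recursive record of which received packets were used.

    Honest packets that span the file are enough to expose a wrong packet: if it
    has the right inner products with all of them, and the right norm, then it
    differs from the packet it replaces by a vector of norm zero.  Any d - T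
    packets span the file because its dimension is at most (d - T) beta.  So every
    wrong packet of a repair is in conflict with a correct one, and the wrong ones
    form a tight vertex cover of the conflict graph.  The new node ignores the
    union of all tight vertex covers of size at most T, which has at most F(T)
    elements, and is rebuilt from d - F(T) packets that are certainly correct.
    A cut-set argument by induction on the age of the nodes then shows that any
    k - F(T) nodes determine the file, and F(T) >= 2 T makes decoding from k
    downloads, at most T of them wrong, unambiguous. *)

Local Open Scope nat_scope.

(** * Vertex covers of bounded size *)

Section Covers.
Variables (V : finType) (e : rel V).
Hypothesis e_sym : symmetric e.

Definition cover_set (E : {set V}) :=
  [forall i, forall j, e i j ==> (i \in E) || (j \in E)].

(** Without loops these are the inclusion-minimal covers; a packet that fits no file will give a
    loop. *)
Definition tight_cover (E : {set V}) :=
  cover_set E && [forall i in E, exists j, (j \notin E) && e i j].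

Definition suspects (t : nat) : {set V} :=
  \bigcup_(E : {set V} | (#|E| <= t) && tight_cover E) E.

Lemma cover_setP (E : {set V}) :
  reflect (forall i j, e i j -> i \notin E -> j \in E) (cover_set E).
Proof.
apply: (iffP 'forall_forallP) => H i j.
  by move=> eij /negbTE iE; have := H i j; rewrite eij iE.
by apply/implyP => eij; case: (boolP (i \in E)) => //= /(H _ _ eij) ->.
Qed.

Let nbrs (W Z : {set V}) := [set j | (j \notin W) && [exists i in Z, e i j]].

Lemma nbrsU (W Z Z' : {set V}) : nbrs W (Z :|: Z') = nbrs W Z :|: nbrs W Z'.
Proof.
apply/setP => j; rewrite !inE -andb_orr; congr (_ && _).
apply/exists_inP/orP.
  by case=> i /setUP[iZ|iZ] eij; [left|right]; apply/exists_inP; exists i.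
by case=> /exists_inP[i iZ eij]; exists i => //; rewrite inE iZ ?orbT.
Qed.

Lemma nbrsS (W Z Z' : {set V}) : Z \subset Z' -> nbrs W Z \subset nbrs W Z'.
Proof. by move=> /setUidPr <-; rewrite nbrsU subsetUl. Qed.

Section MinCover.
Variables (t : nat) (W : {set V}).
Hypothesis Wcov : cover_set W.
Hypothesis Wmin : forall E : {set V}, cover_set E -> #|W| <= #|E|.
Hypothesis Wt : #|W| <= t.

(* Hall's condition: otherwise exchanging Z for its neighbours would shrink W. *)
Lemma min_cover_hall (E Z : {set V}) :
  cover_set E -> Z \subset W :\: E -> #|Z| <= #|nbrs W Z|.
Proof.
move=> /cover_setP Ecov /subsetP ZWE.
have ZW : Z \subset W by apply/subsetP => i /ZWE; rewrite inE => /andP[].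
have ZE i : i \in Z -> i \notin E by move=> /ZWE; rewrite inE => /andP[].
have cov : cover_set ((W :\: Z) :|: nbrs W Z).
  apply/cover_setP => i j eij; rewrite !inE !negb_or !negb_and !negbK.
  case/andP => iZW iN; have [jZ|jZ] /= := boolP (j \in Z).
    rewrite (subsetP ZW _ jZ) /=; case/orP: iZW => [/ZE iE|iW].
      by have := Ecov _ _ eij iE; rewrite (negbTE (ZE _ jZ)).
    move: iN; rewrite (negbTE iW) /= => /exists_inP nex; case: nex; exists j => //.
    by rewrite e_sym eij.
  have [//|jW] /= := boolP (j \in W).
  case/orP: iZW => [iZ|iW]; first by apply/exists_inP; exists i.
  by move/cover_setP: Wcov => /(_ _ _ eij iW); rewrite (negbTE jW).
have := leq_trans (Wmin cov) (leq_card_setU _ _).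
rewrite cardsD (setIidPr ZW); have := subset_leq_card ZW; lia.
Qed.

(** As [E] covers, all these neighbours lie in [E :\: W]. *)
Lemma nbrs_bound (E : {set V}) :
  cover_set E -> #|E| <= t -> #|nbrs W (W :\: E)| <= t - #|W| + #|W :\: E|.
Proof.
move=> /cover_setP Ecov Et.
have sub : nbrs W (W :\: E) \subset E :\: W.
  apply/subsetP => j; rewrite !inE => /andP[-> /exists_inP[i]].
  by rewrite inE => /andP[iE _] eij; rewrite (Ecov _ _ eij).
have := subset_leq_card sub; rewrite !cardsD setIC.
have := subset_leq_card (subsetIl W E); lia.
Qed.

(** Adding [Y = W :\: E] to the union [Z] brings at most [t - #|W| + #|Y :\: Z|] new neighbours: by
    Hall's condition at least [#|Y :&: Z|] neighbours of [Y] already belong to [Z]'s. *)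
Lemma nbrs_union_bound (s : seq {set V}) :
  all (fun E : {set V} => (#|E| <= t) && cover_set E) s ->
  #|nbrs W (\bigcup_(E <- s) (W :\: E))|
    <= #|\bigcup_(E <- s) (W :\: E)| * (t - #|W|).+1.
Proof.
elim: s => [|E s IH] /=.
  move=> _; rewrite big_nil cards0 mul0n leqn0 cards_eq0; apply/eqP/setP => j.
  by rewrite !inE; apply/negbTE/nandP; right; apply/exists_inPn => i; rewrite inE.
case/andP=> /andP[Et Ec] /IH {}IH; rewrite big_cons.
set Z := \bigcup_(E <- s) _ in IH *; set Y := W :\: E.
have [YZ|YZ] := boolP (Y \subset Z); first by rewrite (setUidPr YZ).
have hall : #|Y :&: Z| <= #|nbrs W Y :&: nbrs W Z|.
  apply: leq_trans (min_cover_hall Ec (subsetIl _ _)) _.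
  by apply/subset_leq_card/subsetIP; split; apply: nbrsS; rewrite (subsetIl, subsetIr).
have := nbrs_bound Ec Et; rewrite -/Y nbrsU !cardsU.
have pos : 0 < #|Y :\: Z| by rewrite card_gt0 setD_eq0.
move: pos; rewrite cardsD.
have := subset_leq_card (subsetIl Y Z).
have := subset_leq_card (subsetIr Y Z).
move: hall IH; set x := #|nbrs W Y|; set c := t - #|W|.
move: #|nbrs W Y :&: _| #|Y :&: Z| #|Y| #|Z| #|nbrs W Z| => p q y z n.
move=> h1 h2 h3 h4 h5 h6.
have : y - q + c <= (y - q) * c.+1 by nia.
have -> : (y + z - q) * c.+1 = z * c.+1 + (y - q) * c.+1 by rewrite -mulnDl; congr (_ * _); lia.
lia.
Qed.

(** A vertex of a tight cover [E] lying outside [W] has a neighbour outside [E], which [W] must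
    contain; so the vertex is a neighbour of [W :\: E]. *)
Lemma suspects_min_cover : #|suspects t| <= #|W| * (t - #|W|).+2.
Proof.
pose s := [seq E : {set V} <- enum {: {set V}} | (#|E| <= t) && tight_cover E].
pose Z := \bigcup_(E <- s) (W :\: E).
have sub : suspects t \subset W :|: nbrs W Z.
  apply/subsetP => j /bigcupP[E /andP[Et Etc] jE]; rewrite inE.
  have [//|jW] /= := boolP (j \in W); rewrite inE jW /=.
  have /andP[Ec /forall_inP/(_ _ jE)/existsP[i /andP[iE eij]]] := Etc.
  have iW : i \in W by move/cover_setP: Wcov => /(_ _ _ eij jW).
  apply/exists_inP; exists i; last by rewrite e_sym.
  rewrite /Z; have Es : E \in s by rewrite mem_filter Et Etc mem_enum.
  by rewrite (big_rem E) //= !inE iE iW.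
have all_s : all (fun E : {set V} => (#|E| <= t) && cover_set E) s.
  by apply/allP => E; rewrite mem_filter => /andP[/andP[-> /andP[-> _]]].
have ZW : Z \subset W.
  by rewrite /Z; elim/big_ind: _ => [|A B|? _];
    rewrite ?sub0set ?subUset ?subsetDl // => -> ->.
apply: leq_trans (subset_leq_card sub) (leq_trans (leq_card_setU _ _) _).
have := nbrs_union_bound all_s; rewrite -/Z; have := subset_leq_card ZW; nia.
Qed.

End MinCover.

(** A minimum cover of size [w] gives the bound [w * (t - w + 2)], which never exceeds [FT t]. If no
    cover has size at most [t], the union is empty. *)
Lemma card_suspects (t : nat) : #|suspects t| <= FT t.
Proof.
have [E0 /andP[E0t E0c]|none] := pickP (fun E : {set V} => (#|E| <= t) && cover_set E); last first.
  rewrite /suspects big_pred0 ?cards0 // => E.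
  by rewrite /tight_cover andbA none.
case: (@arg_minnP _ E0 cover_set (fun E : {set V} => #|E|) E0c) => W Wc Wmin.
have Wt := leq_trans (Wmin _ E0c) E0t.
apply: leq_trans (suspects_min_cover Wc Wmin Wt) _.
rewrite /FT; move: #|W| Wt => w wt.
have -> : t = w + (t - w) by lia.
move: (t - w) => c; rewrite addKn.
case: w {wt} => [|w]; first by rewrite mul0n.
have : w * c.+1 <= (w.+1 + c) * (w.+1 + c) %/ 4.
  by have := leq_of_leqif (nat_AGM2 w c.+1); rewrite leq_divRL // mulnn addSnnS [4 * _]mulnC.
by rewrite !mulnS mulSn; lia.
Qed.

Lemma tight_sub_suspects (t : nat) (E : {set V}) :
  #|E| <= t -> tight_cover E -> E \subset suspects t.
Proof. by move=> Et Ec; apply: (bigcup_sup E); rewrite Et Ec. Qed.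

End Covers.

(** * Generic subspaces *)

Section Generic.
Local Open Scope ring_scope.
Variable m : nat.
Implicit Types (s : seq 'M[rat]_m) (U : 'M[rat]_m).

(** The line [u + c *: w] meets a subspace not containing [w] for at most one [c], so more scalars
    than subspaces suffice. *)
Lemma avoid_scalars s (w u : 'rV[rat]_m) (cs : seq rat) :
  uniq cs -> (size s < size cs)%N -> (forall U, U \in s -> ~~ (w <= U)%MS) ->
  exists2 c, c \in cs & forall U, U \in s -> ~~ ((u + c *: w)%R <= U)%MS.
Proof.
elim: s cs => [|U s IH] cs ucs scs wU.
  by case: cs scs {ucs} => // c cs _; exists c; rewrite ?mem_head.
pose ok c := ~~ ((u + c *: w)%R <= U)%MS.
have bad1 : (count (predC ok) cs <= 1)%N.
  rewrite leqNgt; apply/negP => two.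
  have : uniq (filter (predC ok) cs) by rewrite filter_uniq.
  have := two; rewrite -size_filter.
  have : all (predC ok) (filter (predC ok) cs) by rewrite filter_all.
  case: (filter _ _) => [|x [|y r]] //= /and3P[/negPn okx /negPn oky _] _.
  rewrite inE negb_or => /andP[/andP[xy _] _].
  have /negP[] := wU U (mem_head _ _).
  have : ((x - y) *: w <= U)%MS.
    rewrite (_ : _ *: w = (u + x *: w) - (u + y *: w)).
      by rewrite addmx_sub // eqmx_opp.
    by rewrite scalerBl opprD addrACA subrr add0r.
  by rewrite eqmx_scale // subr_eq0.
have [|||c] := IH (filter ok cs).
- by rewrite filter_uniq.
- by rewrite size_filter; move: scs bad1; rewrite -(count_predC ok cs) /=; lia.
- by move=> U' sU'; apply: wU; rewrite inE sU' orbT.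
rewrite mem_filter => /andP[okc ccs] H; exists c => // U'; rewrite inE.
by case/predU1P => [->//|/H].
Qed.

(** If the vector [w] found so far falls into the next subspace [U], it becomes [u + c *: w] with
    [u] a row of [W] outside [U]: this leaves [U] for every [c], and [c] is chosen to avoid the
    others. *)
Lemma avoid_subspaces p (W : 'M[rat]_(p, m)) s :
  exists2 w : 'rV[rat]_m, (w <= W)%MS &
    forall U, U \in s -> ~~ (W <= U)%MS -> ~~ (w <= U)%MS.
Proof.
elim: s => [|U s [w wW wP]]; first by exists 0; rewrite ?sub0mx.
have [WU|] := boolP (W <= U)%MS.
  by exists w => // U'; rewrite inE => /predU1P[->|/wP//]; rewrite WU.
case/row_subPn => i; set u := row i W => uU.
have [wU|wU] := boolP (w <= U)%MS; last first.
  by exists w => // U'; rewrite inE => /predU1P[->|/wP].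
pose s' := [seq U' <- s | ~~ (W <= U')%MS].
have [||U'|c _ cP] := @avoid_scalars s' w u [seq j%:R | j <- iota 0 (size s').+1].
- by rewrite map_inj_uniq ?iota_uniq //; apply: mulrIn; rewrite oner_eq0.
- by rewrite size_map size_iota.
- by rewrite mem_filter => /andP[WU' /wP]; apply.
exists (u + c *: w); first by rewrite addmx_sub ?row_sub // scalemx_sub.
move=> U'; rewrite inE => /predU1P[-> _|sU' WU']; last by apply: cP; rewrite mem_filter WU'.
apply: contra uU => ucw; rewrite -[u](addrK (c *: w)) addmx_sub // eqmx_opp.
exact: scalemx_sub.
Qed.

(** Vectors are added one at a time, each avoiding every [U + P] that does not contain [W]; each
    raises the rank of [U + P] until [W] is absorbed. *)
Lemma generic_subspace p b (W : 'M[rat]_(p, m)) s :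
  exists2 P : 'M[rat]_(b, m), (P <= W)%MS &
    forall U, U \in s -> (minn (\rank U + b) (\rank (U + W)) <= \rank (U + P))%N.
Proof.
elim: b => [|b [P PW IH]].
  exists 0; first by rewrite sub0mx.
  by move=> U _; rewrite addn0 geq_min mxrankS ?addsmxSl.
have [w wW wP] := avoid_subspaces W [seq (U + P)%MS | U <- s].
pose Q : 'M_(b.+1, m) := col_mx w P.
have QW : (Q <= W)%MS by move: (col_mx_sub w P W); rewrite wW PW.
have wQ : (w <= Q)%MS by have := addsmxSl w P; rewrite addsmxE.
have PQ : (P <= Q)%MS by have := addsmxSr w P; rewrite addsmxE.
exists Q => // U sU; have := IH U sU.
have le1 : (U + P <= U + Q)%MS by rewrite addsmxS.
have [WU|WU] := boolP (W <= U + P)%MS.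
  have /mxrankS : (U + W <= U + Q)%MS.
    by rewrite addsmx_sub addsmxSl (submx_trans WU).
  by move=> le _; rewrite geq_min le orbT.
have lt1 : (U + P < U + Q)%MS.
  rewrite /ltmx le1 /=; apply: contra (wP _ (map_f _ sU) WU) => le2.
  by apply: submx_trans le2; apply: submx_trans wQ (addsmxSr _ _).
have := rank_ltmx lt1.
rewrite !geq_min; lia.
Qed.

End Generic.

(** * Generic repair systems *)

Section Spaces.
Variables (m : nat) (V : finType).

Definition joint_space p (C : V -> 'M[rat]_(p, m)) (A : {set V}) : 'M[rat]_m :=
  (\sum_(v in A) <<C v>>)%MS.

Lemma space_subP p (C : V -> 'M[rat]_(p, m)) (A : {set V}) q (X : 'M[rat]_(q, m)) :
  reflect (forall v, v \in A -> (C v <= X)%MS) (joint_space C A <= X)%MS.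
Proof.
by apply: (iffP sumsmx_subP) => H v vA; have := H v vA; rewrite genmxE.
Qed.

Lemma sub_space p (C : V -> 'M[rat]_(p, m)) (A : {set V}) v :
  v \in A -> (C v <= joint_space C A)%MS.
Proof. by move=> vA; apply: (sumsmx_sup v) => //; rewrite genmxE. Qed.

Lemma spaceS p (C : V -> 'M[rat]_(p, m)) (A B : {set V}) :
  A \subset B -> (joint_space C A <= joint_space C B)%MS.
Proof. by move=> /subsetP AB; apply/space_subP => v /AB; apply: sub_space. Qed.

End Spaces.

(** Versions with one name are alternative histories of one node, so only sets with distinct names
    can occur together. *)
Definition distinct (V : finType) (name : V -> nat) (A : {set V}) :=
  {in A &, injective name}.

Lemma distinctS (V : finType) (name : V -> nat) (A B : {set V}) :
  A \subset B -> distinct name B -> distinct name A.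
Proof. by move=> /subsetP AB H x y /AB xB /AB yB; apply: H. Qed.

Lemma card_names (V : finType) (name : V -> nat) (A B : {set V}) :
  distinct name A -> (forall v, v \in A -> exists2 u, u \in B & name u = name v) ->
  #|A| <= #|B|.
Proof.
move=> dA AB; rewrite !cardE -(size_map name (enum A)) -(size_map name (enum B)).
apply: uniq_leq_size => [|x /mapP[v]].
  by rewrite map_inj_in_uniq ?enum_uniq // => x y; rewrite !mem_enum; apply: dA.
rewrite mem_enum => /AB[u uB <-] ->; apply: map_f; by rewrite mem_enum.
Qed.

(* A cut isolating [j] nodes pays, for the [i]-th oldest of them, either its whole content
   or the messages of its at least [delta - i] helpers outside the cut. *)
Definition cut_bound (a b delta j : nat) : nat := \sum_(i < j) minn a ((delta - i) * b).

Section System.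
Variables (m a b delta kappa : nat).
Hypothesis kd : kappa <= delta.
Hypothesis ba : b <= a.
Hypothesis mk : m <= cut_bound a b delta kappa.

Local Notation h := (cut_bound a b delta).

Lemma cut_boundS j : h j.+1 = h j + minn a ((delta - j) * b).
Proof. by rewrite /cut_bound big_ord_recr. Qed.

Lemma cut_bound_mono : {homo h : i j / i <= j}.
Proof. by apply: homo_leq leqnn leq_trans _ => j; rewrite cut_boundS leq_addr. Qed.

(** Replacing a message by a whole content does not weaken the bound: below [kappa] the content
    counts for at least [b], and from [kappa] on the bound is already capped by [m]. *)
Lemma min_cutS j x : minn m (h j + (b + x)) <= minn m (h j.+1 + x).
Proof.
have [jk|kj] := ltnP j kappa; last first.
  have := cut_bound_mono kj; rewrite cut_boundS; lia.
rewrite cut_boundS; suff : b <= minn a ((delta - j) * b) by lia.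
by rewrite leq_min ba leq_pmull // subn_gt0 (leq_trans jk).
Qed.

Section Stage.
Variables (V : finType) (name : V -> nat) (C : V -> 'M[rat]_(a, m)).
Hypothesis rankC : forall A : {set V}, distinct name A ->
  minn m (h #|A|) <= \rank (joint_space C A).

(** Messages are chosen version by version, generic in [C v] relative to all sums of contents and
    earlier messages. The rank grows by [b] or reaches the sum with all of [C v]; then [v] counts as
    a content and [min_cutS] applies. *)
Lemma generic_messages : exists2 M : V -> 'M[rat]_(b, m),
  (forall v, (M v <= C v)%MS) &
  forall A E : {set V}, distinct name (A :|: E) -> [disjoint A & E] ->
    minn m (h #|A| + #|E| * b) <= \rank (joint_space C A + joint_space M E).
Proof.
suff [M MC rankM] : exists2 M : V -> 'M[rat]_(b, m),
  (forall v, (M v <= C v)%MS) &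
  forall A E : {set V}, distinct name (A :|: E) -> [disjoint A & E] ->
    E \subset enum V ->
    minn m (h #|A| + #|E| * b) <= \rank (joint_space C A + joint_space M E).
  exists M => // A E dAE AE; apply: rankM => //.
  by apply/subsetP => v _; rewrite mem_enum.
elim: (enum V) => [|v s [M MC IH]].
  exists (fun=> 0%R) => [v|A E dAE _ sE]; first exact: sub0mx.
  have -> : E = set0.
    by apply/setP => v; rewrite inE; apply/negbTE/negP => /(subsetP sE).
  rewrite cards0 addn0; have := rankC (distinctS (subsetUl A E) dAE).
  by move/leq_trans; apply; apply: mxrankS (addsmxSl _ _).
pose us := [seq (joint_space C p.1 + joint_space M p.2)%MS | p : {set V} * {set V}].
have [P PC rankP] := generic_subspace b (C v) us.
pose M' x := if x == v then P else M x.
exists M' => [x|A E dAE AE sE].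
  by rewrite /M'; case: eqP => [->|].
have sameM (E' : {set V}) : v \notin E' -> joint_space M' E' = joint_space M E'.
  move=> vE'; apply: eq_bigr => x xE'; rewrite /M'.
  by case: eqP xE' vE' => // -> ->.
have [vE|vE] := boolP (v \in E); last first.
  rewrite sameM //; apply: IH => //; apply/subsetP => x xE.
  by have := subsetP sE _ xE; rewrite inE => /predU1P[xv|//]; rewrite -xv xE in vE.
have vA : v \notin A by rewrite (disjointFl AE).
pose E0 := E :\ v.
have E0s : E0 \subset s.
  apply/subsetP => x; rewrite !inE => /andP[xv xE].
  by have := subsetP sE _ xE; rewrite inE (negbTE xv).
have cE : #|E| = #|E0|.+1 by rewrite (cardsD1 v) vE.
have dAE0 : A :|: E0 \subset A :|: E by rewrite setUS // subsetDl.
have AE0 : [disjoint A & E0] by apply: disjointWr AE; apply: subsetDl.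
have r1 := IH _ _ (distinctS dAE0 dAE) AE0 E0s.
have r2 : minn m (h #|A|.+1 + #|E0| * b) <= \rank (joint_space C A + joint_space M E0 + C v).
  have : v |: A :|: E0 \subset A :|: E.
    by apply/subsetP => x; rewrite !inE; case: eqP => [->|_] //=; rewrite vE orbT.
  move=> /distinctS/(_ dAE)/IH/(_ _ E0s); rewrite cardsU1 vA add1n.
  have dj : [disjoint v |: A & E0].
    rewrite disjoints_subset subUset sub1set !inE eqxx /=.
    by rewrite -disjoints_subset.
  move=> /(_ dj)/leq_trans; apply; apply: mxrankS.
  rewrite addsmx_sub; apply/andP; split; last first.
    by apply: submx_trans (addsmxSl _ _); apply: addsmxSr.
  apply/space_subP => x; rewrite !inE => /predU1P[->|xA]; first exact: addsmxSr.
  apply: submx_trans (addsmxSl _ _); apply: submx_trans (addsmxSl _ _).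
  exact: sub_space.
have : (joint_space C A + joint_space M E0)%MS \in us.
  by apply/imageP; exists (A, E0).
move=> /rankP; have := min_cutS #|A| (#|E0| * b).
have : (joint_space C A + joint_space M E0 + P <= joint_space C A + joint_space M' E)%MS.
  have PM : (P <= joint_space M' E)%MS.
    by have := sub_space M' vE; rewrite /M' eqxx.
  rewrite addsmx_sub (submx_trans PM (addsmxSr _ _)) andbT addsmxS //.
  by rewrite -sameM ?setD11 // spaceS // subsetDl.
move/mxrankS; rewrite cE mulSn; lia.
Qed.


Lemma generic_full : exists P : 'M[rat]_(a, m), forall A : {set V},
  distinct name A -> minn m (h #|A|.+1) <= \rank (joint_space C A + P).
Proof.
have [P _ rankP] := generic_subspace a 1%:M%R [seq joint_space C A | A : {set V}].
exists P => A dA.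
have /rankP : joint_space C A \in [seq joint_space C A | A : {set V}] by apply: image_f.
have : (1%:M%R <= joint_space C A + 1%:M%R)%MS by apply: addsmxSr.
move/mxrankS; rewrite mxrank1; have := rankC dA.
rewrite cut_boundS; have := geq_minl a ((delta - #|A|) * b).
move: (\rank (joint_space C A)) (\rank (joint_space C A + 1%:M%R)).
move: (\rank (joint_space C A + P)) (minn a _); lia.
Qed.

(** This is the cut-set step: either the rank grows by [a], or it reaches the rank with all messages
    of [I], of which at least [delta - #|A|] come from nodes without a version in [A]. *)
Lemma generic_content (M : V -> 'M[rat]_(b, m)) (I : {set V}) :
  (forall A E : {set V}, distinct name (A :|: E) -> [disjoint A & E] ->
    minn m (h #|A| + #|E| * b) <= \rank (joint_space C A + joint_space M E)) ->
  distinct name I -> #|I| = delta ->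
  exists2 P : 'M[rat]_(a, m), (P <= joint_space M I)%MS &
    forall A : {set V}, distinct name A ->
      minn m (h #|A|.+1) <= \rank (joint_space C A + P).
Proof.
move=> rankM dI cI.
have [P PI rankP] := generic_subspace a (joint_space M I) [seq joint_space C A | A : {set V}].
exists P => // A dA.
have /rankP : joint_space C A \in [seq joint_space C A | A : {set V}] by apply: image_f.
apply: leq_trans; rewrite cut_boundS leq_min; apply/andP; split.
  have := rankC dA; have := geq_minl a ((delta - #|A|) * b); lia.
(* Names are compared rather than versions, because [A] may contain another version of a helper. *)
pose E := [set v in I | ~~ [exists u in A, name u == name v]].
have EA u v : u \in E -> v \in A -> name u <> name v.
  by rewrite inE => /andP[_ /exists_inPn H] /H /eqP + e; apply.
have dAE : distinct name (A :|: E).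
  move=> x y /setUP[xA|xE] /setUP[yA|yE] e.
  - exact: dA.
  - by case: (EA y x yE xA).
  - by case: (EA x y xE yA).
  - by apply: dI => //; [case/setIdP: xE | case/setIdP: yE].
have AE : [disjoint A & E].
  by rewrite disjoint_subset; apply/subsetP => v vA; apply/negP => vE; case: (EA v v).
have cE : delta - #|A| <= #|E|.
  have EI : E \subset I by apply/subsetP => v /setIdP[].
  rewrite leq_subLR -cI addnC -(cardsID E I) (setIidPr EI) leq_add2l.
  apply: card_names (distinctS (subsetDl _ _) dI) _ => v; rewrite !inE.
  case/andP => + vI; rewrite vI /= negbK => /exists_inP[u uA /eqP e].
  by exists u.
have := rankM _ _ dAE AE.
have : (joint_space C A + joint_space M E <= joint_space C A + joint_space M I)%MS.
  by rewrite addsmxS // spaceS //; apply/subsetP => v /setIdP[].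
move/mxrankS; have : (delta - #|A|) * b <= #|E| * b by rewrite leq_mul2r cE orbT.
have := geq_minr a ((delta - #|A|) * b); lia.
Qed.

End Stage.

(** The family is fixed before the evolution is known: it has a version for every possible set of
    helper versions, and an evolution merely selects among them. *)
Record repair_system (W : nat) (V : finType) (name : V -> nat)
    (C : V -> 'M[rat]_(a, m)) (M : V -> nat -> 'M[rat]_(b, m)) : Prop := {
  sys_name : forall v, name v < W;
  sys_content : forall A : {set V}, distinct name A ->
    minn m (h #|A|) <= \rank (joint_space C A);
  sys_msg : forall v w, (M v w <= C v)%MS;
  sys_helpers : forall w (E : {set V}), w < W -> distinct name E ->
    (forall v, v \in E -> name v < w) ->
    minn m (#|E| * b) <= \rank (joint_space (M^~ w) E);
  sys_init : forall w, w < W -> exists v, name v = w;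
  sys_repair : forall w (I : {set V}), w < W -> distinct name I -> #|I| = delta ->
    (forall v, v \in I -> name v < w) ->
    exists2 v, name v = w & (C v <= joint_space (M^~ w) I)%MS }.

(* A system for [W] nodes is extended by one version of node [W] for every set of
   older versions; for a set that is not a possible set of helpers the constraint
   is void, and the content is generic in the whole space. *)
Section Extension.
Variables (W : nat) (V : finType) (name : V -> nat).
Variables (C : V -> 'M[rat]_(a, m)) (M : V -> nat -> 'M[rat]_(b, m)).
Hypothesis sys : repair_system W name C M.
Variables (Mw : V -> 'M[rat]_(b, m)) (Cw : {set V} -> 'M[rat]_(a, m)).
Hypothesis Mw_msg : forall v, (Mw v <= C v)%MS.
Hypothesis rankMw : forall E : {set V}, distinct name E ->
  minn m (#|E| * b) <= \rank (joint_space Mw E).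
Hypothesis Cw_repair : forall I : {set V}, distinct name I -> #|I| = delta ->
  (Cw I <= joint_space Mw I)%MS.
Hypothesis rankCw : forall I A : {set V}, distinct name A ->
  minn m (h #|A|.+1) <= \rank (joint_space C A + Cw I).

Let V' : finType := (V + {set V})%type.
Let name' (v : V') := if v is inl u then name u else W.
Let C' (v : V') := match v with inl u => C u | inr J => Cw J end.
(** The value [0] is a placeholder: node [W] sends nothing to nodes up to [W], and its messages to
    later nodes are set by later extensions. *)
Let M' (v : V') (w : nat) := if v is inl u then (if w == W then Mw u else M u w) else 0%R.

Let old (A : {set V'}) : {set V} := [set v | inl v \in A].

Lemma distinct_old (A : {set V'}) : distinct name' A -> distinct name (old A).
Proof.
move=> dA x y; rewrite !inE => xA yA e.
by have [] := dA (inl x) (inl y) xA yA e.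
Qed.

Lemma card_old (A : {set V'}) : (forall v, v \in A -> name' v < W) -> #|old A| = #|A|.
Proof.
move=> AW; rewrite -(card_imset _ (@inl_inj V {set V})); apply: eq_card => v.
apply/imsetP/idP => [[u + ->]|vA]; first by rewrite inE.
by case: v vA (AW v vA) => [u|I] vA; rewrite /= ?ltnn // => _; exists u; rewrite ?inE.
Qed.

Lemma space_old p (D : V -> 'M[rat]_(p, m)) (D' : V' -> 'M[rat]_(p, m)) (A : {set V'}) :
  (forall v, D' (inl v) = D v) -> (joint_space D (old A) <= joint_space D' A)%MS.
Proof.
by move=> DD'; apply/space_subP => v; rewrite inE => vA; rewrite -DD'; apply: sub_space.
Qed.

Lemma extend_system : repair_system W.+1 name' C' M'.
Proof.
case: sys => sn sc sm sh si sr; split.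
- by case=> [v|I] //=; rewrite ltnS // ltnW.
- move=> A dA; have CA := space_old A (fun v => erefl (C' (inl v))).
  have [I IA|none] := pickP [pred I | inr I \in A]; last first.
    have <- : #|old A| = #|A|.
      by apply: card_old => -[v|I] /=; rewrite ?sn // => /(introT idP); rewrite [_ \in _]none.
    exact: leq_trans (sc _ (distinct_old dA)) (mxrankS CA).
  (* All new versions bear the name [W], so [A] contains only one of them. *)
  have cA : #|A| <= #|old A|.+1.
    rewrite (cardsD1 (inr I)) (IA : inr I \in A) add1n ltnS.
    apply: leq_trans (_ : #|old (A :\ inr I)| <= _); last first.
      by apply: subset_leq_card; apply/subsetP => v; rewrite !inE.
    rewrite card_old // => -[v|J]; rewrite !inE ?sn // => /andP[JI JA].
    by case/eqP: JI; apply: dA.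
  have := rankCw I (distinct_old dA); have := cut_bound_mono cA.
  have : (joint_space C (old A) + Cw I <= joint_space C' A)%MS.
    by rewrite addsmx_sub CA; apply: (@sub_space _ _ _ C' A (inr I)).
  move/mxrankS; lia.
- case=> [v|I] w /=; last exact: sub0mx.
  by case: eqP.
- move=> w E; rewrite ltnS => wW dE Ew.
  have EW v : v \in E -> name' v < W by move=> /Ew /leq_trans; apply.
  rewrite -(card_old EW).
  have [e|wnW] := eqVneq w W.
    apply: leq_trans (rankMw (distinct_old dE)) (mxrankS _).
    by apply: space_old => v; rewrite /M' e eqxx.
  have wltW : w < W by rewrite ltn_neqAle wnW.
  apply: leq_trans (sh w _ wltW (distinct_old dE) _) (mxrankS _).
    by move=> v; rewrite inE => /Ew.
  by apply: space_old => v; rewrite /M' (negbTE wnW).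
- move=> w; rewrite ltnS leq_eqVlt => /predU1P[->|/si[v <-]].
    by exists (inr set0).
  by exists (inl v).
- move=> w I; rewrite ltnS => wW dI cI Iw.
  have IW v : v \in I -> name' v < W by move=> /Iw /leq_trans; apply.
  have cI' : #|old I| = delta by rewrite card_old.
  have dI' := distinct_old dI.
  have [e|wnW] := eqVneq w W.
    exists (inr (old I)) => //=; apply: submx_trans (Cw_repair dI' cI') _.
    by apply: space_old => v; rewrite /M' e eqxx.
  have wltW : w < W by rewrite ltn_neqAle wnW.
  have [|v nv Cv] := sr w _ wltW dI' cI'; first by move=> v; rewrite inE => /Iw.
  exists (inl v) => //; apply: submx_trans Cv _.
  by apply: space_old => u; rewrite /M' (negbTE wnW).
Qed.

End Extension.

Lemma repair_system_exists (W : nat) : exists (V : finType) (name : V -> nat)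
  (C : V -> 'M[rat]_(a, m)) (M : V -> nat -> 'M[rat]_(b, m)),
  repair_system W name C M.
Proof.
elim: W => [|W [V [name [C [M sys]]]]].
  exists void, (fun=> 0), (fun=> 0%R), (fun=> fun=> 0%R); split => //.
  move=> A _; have -> : A = set0 by apply/setP; case.
  by rewrite cards0 /cut_bound big_ord0 minn0.
have [Mw MwC rankMw] := generic_messages (sys_content sys).
have cw (I : {set V}) : exists P : 'M[rat]_(a, m),
    (distinct name I -> #|I| = delta -> (P <= joint_space Mw I)%MS) /\
    (forall A : {set V}, distinct name A -> minn m (h #|A|.+1) <= \rank (joint_space C A + P)).
  have [/andP[/dinjectiveP dI /eqP cI]|nI] := boolP (dinjectiveb name I && (#|I| == delta)).
    by have [P PI rankP] := generic_content (sys_content sys) rankMw dI cI; exists P.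
  have [P rankP] := generic_full (sys_content sys).
  by exists P; split=> // /dinjectiveP dI /eqP cI; case/negP: nI; apply/andP.
have [Cw CwP] := fin_all_exists cw.
do 4 eexists; apply: (extend_system sys MwC _ (fun I => (CwP I).1) (fun I => (CwP I).2)).
move=> E dE.
have := rankMw set0 E; rewrite set0U cards0 /cut_bound big_ord0 => /(_ dE) H.
apply: leq_trans (H _) (mxrankS _); first by rewrite disjoints_subset sub0set.
by rewrite addsmx_sub submx_refl andbT; apply/space_subP => v; rewrite inE.
Qed.

End System.

(** * The storage protocol *)

Lemma subset_of_card (V : finType) (A : {set V}) n : n <= #|A| ->
  exists2 J : {set V}, J \subset A & #|J| = n.
Proof.
move=> nA; exists [set x in take n (enum A)].
  by apply/subsetP => x; rewrite inE => /mem_take; rewrite mem_enum.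
rewrite cardsE; have /card_uniqP -> : uniq (take n (enum A)) by rewrite take_uniq ?enum_uniq.
by rewrite size_takel // -cardE.
Qed.

Lemma card_controlled d (hs ctrl : seq nat) : uniq hs -> size hs = d ->
  #|[set i : 'I_d | nth 0 hs i \in ctrl]| <= size (undup ctrl).
Proof.
move=> uhs shs; rewrite cardE -(size_map (nth 0 hs \o val)).
apply: uniq_leq_size => [|x /mapP[i]].
  rewrite map_inj_uniq ?enum_uniq // => i j /= /eqP.
  by rewrite nth_uniq ?shs // => /eqP /val_inj.
by rewrite mem_enum inE mem_undup => ci ->.
Qed.

Section Protocol.
Variables (K N k d T L a b m : nat).
Variables (F V : finType) (CT MT : eqType) (name : V -> nat).
(* [cv v X] is what a node of version [v] stores and [mv v w X] what it sends to
   node [w] when the file is [X]; the version records how the node was repaired. *)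
Variables (cv : V -> F -> CT) (mv : V -> nat -> F -> MT).
Variable encF : m.-tuple 'I_K -> F.
Variables (encC : V * CT -> a.-tuple 'I_K) (decC : a.-tuple 'I_K -> V * CT).
Variables (encM : V * MT -> b.-tuple 'I_K) (decM : b.-tuple 'I_K -> V * MT).
Variables (dC : a.-tuple 'I_K) (dM : b.-tuple 'I_K) (dF : m.-tuple 'I_K).

Hypothesis Tk : T < k.
Hypothesis TF : T + T <= FT T.
Hypothesis kd : k <= d.
Hypothesis encF_inj : injective encF.
Hypothesis encCK : forall v X, decC (encC (v, cv v X)) = (v, cv v X).
Hypothesis encMK : forall v w X, w < L -> decM (encM (v, mv v w X)) = (v, mv v w X).
Hypothesis init : forall w, w < N -> exists v, name v = w.
Hypothesis msg_of_content : forall v w X Y, cv v X = cv v Y -> mv v w X = mv v w Y.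
Hypothesis collect : forall (A : {set V}) X Y, distinct name A -> k - FT T <= #|A| ->
  (forall v, v \in A -> cv v X = cv v Y) -> X = Y.
Hypothesis repair : forall w (I : {set V}), w < L -> distinct name I ->
  #|I| = d - FT T -> (forall v, v \in I -> name v < w) ->
  exists2 v, name v = w &
    forall X Y, (forall u, u \in I -> mv u w X = mv u w Y) -> cv v X = cv v Y.
(** The explaining file [Y] may depend on [u]: it is enough that the packet be compatible with the
    correct packets one at a time. *)
Hypothesis detect : forall w (H : {set V}) v y X, w < L -> distinct name H ->
  d - T <= #|H| -> (forall u, u \in H -> name u < w) ->
  (forall u, u \in H -> exists2 Y, y = mv v w Y & mv u w X = mv u w Y) ->
  y = mv v w X.

(** * Repair in the presence of wrong packets *)

Section Regeneration.
Variables (w : nat) (hs : seq nat) (ms : seq (b.-tuple 'I_K)).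

Definition claim (i : 'I_d) : V * MT := decM (nth dM ms i).

Definition fits (i : 'I_d) (X : F) :=
  (name (claim i).1 == nth 0 hs i) && ((claim i).2 == mv (claim i).1 w X).

Definition conflict : rel 'I_d := fun i j => ~~ [exists X, fits i X && fits j X].

(** By the last condition the packets of [J] determine the content of version [v], so the result
    does not depend on which fitting file [X] is found. *)
Definition regenerates (p : {set 'I_d} * V * F) :=
  let: (J, v, X) := p in
  [&& #|J| == d - FT T, J \subset ~: suspects conflict T, name v == w,
      [forall i in J, fits i X] &
      [forall X, forall Y, [forall i in J, mv (claim i).1 w X == mv (claim i).1 w Y]
         ==> (cv v X == cv v Y)]].

Definition regenerate : a.-tuple 'I_K :=
  if [pick p | regenerates p] is Some (_, v, X) then encC (v, cv v X) else dC.

Hypotheses (wL : w < L) (uhs : uniq hs) (shs : size hs = d).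
Hypothesis hsw : all (fun j => j < w) hs.

Lemma fits_distinct X (J : {set 'I_d}) : (forall i, i \in J -> fits i X) ->
  [/\ distinct name [set (claim i).1 | i in J], #|[set (claim i).1 | i in J]| = #|J| &
      forall u, u \in [set (claim i).1 | i in J] -> name u < w].
Proof.
move=> Jfit; have nm i : i \in J -> name (claim i).1 = nth 0 hs i.
  by move=> /Jfit/andP[/eqP].
have inj i j : i \in J -> j \in J -> name (claim i).1 = name (claim j).1 -> i = j.
  move=> iJ jJ; rewrite !nm // => /eqP.
  by rewrite nth_uniq ?shs // => /eqP /val_inj.
split.
- by move=> _ _ /imsetP[i iJ ->] /imsetP[j jJ ->] /inj ->.
- by apply: card_in_imset => i j iJ jJ e; apply: inj; rewrite ?e.
- move=> _ /imsetP[i iJ ->]; rewrite nm //.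
  by apply: (allP hsw); rewrite mem_nth ?shs.
Qed.

(** Two packets fitting [X] do not conflict, so the misfits form a cover. It is tight: a packet in
    conflict with no fitting packet passes [detect] and hence fits [X]. *)
Lemma misfits_suspect X (H := [set i | fits i X]) :
  #|~: H| <= T -> ~: H \subset suspects conflict T.
Proof.
move=> HT; apply: tight_sub_suspects => //; apply/andP; split.
  apply/cover_setP => i j ij; rewrite !inE negbK => iH; apply/negP => jH.
  by case/existsP: ij; exists X; rewrite iH jH.
apply/forall_inP => i; rewrite !inE => niX.
have cH : d - T <= #|H| by move: HT; rewrite cardsCs setCK card_ord; lia.
have [j0 jH0] : exists j, j \in H.
  by apply/set0Pn; rewrite -card_gt0; apply: leq_trans cH; lia.
apply: contraNT niX => /existsPn noconf.
have agree j : j \in H -> exists2 Y, fits i Y & fits j Y.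
  move=> jH; have := noconf j; rewrite inE jH /= negbK => /existsP[Y /andP[iY jY]].
  by exists Y.
have Hfit j : j \in H -> fits j X by rewrite inE.
have [dH cH' Hw] := fits_distinct Hfit.
have [Y /andP[ni _] _] := agree j0 jH0.
rewrite /fits ni /=; apply/eqP; apply: (detect wL dH) => //; first by rewrite cH'.
move=> _ /imsetP[j jH ->]; have [Z /andP[_ /eqP iZ] /andP[_ /eqP jZ]] := agree j jH.
by exists Z => //; rewrite -jZ; have /andP[_ /eqP] := Hfit j jH.
Qed.

(** All packets outside the suspects fit [X], so whatever triple is picked yields the content for
    [X]; a triple exists because at least [d - FT T] packets remain. *)
Lemma regenerateP X (B : {set 'I_d}) : #|B| <= T ->
  (forall i, i \notin B -> fits i X) ->
  exists2 v, name v = w & regenerate = encC (v, cv v X).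
Proof.
move=> BT fit; set H := [set i | fits i X].
have HT : #|~: H| <= T.
  apply: leq_trans BT; apply/subset_leq_card/subsetP => i; rewrite !inE.
  by apply: contraNT => /fit.
have susp := misfits_suspect HT.
have trusted (J : {set 'I_d}) i : J \subset ~: suspects conflict T -> i \in J -> fits i X.
  move=> /subsetP sJ /sJ; rewrite inE; apply: contraNT => niX.
  by apply: (subsetP susp); rewrite !inE.
rewrite /regenerate; case: pickP => [[[J v] Y] /and5P[_ sJ /eqP nv /forall_inP fY det]|none].
  exists v => //; congr (encC (_, _)); apply/eqP.
  have /forallP/(_ Y)/forallP/(_ X)/implyP := det; apply.
  apply/forall_inP => i iJ.
  have /andP[_ /eqP <-] := fY i iJ.
  by have /andP[_ /eqP ->] := trusted J i sJ iJ.
have [|J sJ cJ] := @subset_of_card _ (~: suspects conflict T) (d - FT T).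
  by rewrite cardsCs setCK card_ord leq_sub2l // card_suspects // => i j;
    rewrite /conflict; under eq_existsb do rewrite andbC.
have [dI cI Iw] := fits_distinct (fun i => trusted J i sJ).
have [v nv det] := repair wL dI (etrans cI cJ) Iw.
have /negP[] := negbT (none (J, v, X)).
rewrite /regenerates cJ nv sJ !eqxx /=; apply/andP; split.
  by apply/forall_inP => i; apply: trusted.
apply/forallP => Y; apply/forallP => Z; apply/implyP => /forall_inP e.
by apply/eqP/det => _ /imsetP[i iJ ->]; apply/eqP/e.
Qed.

End Regeneration.

(** * The code and its run along an evolution *)

Definition is_repair (e : event) := if e is Repair _ _ then true else false.
Definition event_nodes (e : event) := match e with Repair _ s | Collect s => s end.
(** The history already contains the repair in progress, hence the predecessor. *)
Definition new_name (h : seq event) := N + (count is_repair h).-1.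
Definition last_nodes (h : seq event) := event_nodes (last (Collect [::]) h).

Definition agrees (s : seq nat) (ds : seq (a.-tuple 'I_K)) (X : F) : {set 'I_k} :=
  [set i : 'I_k | let c := decC (nth dC ds i) in
           (name c.1 == nth 0 s i) && (c.2 == cv c.1 X)].

(** A helper does not know the file: it acts on any file compatible with its content, which yields
    the right message by [msg_of_content]. *)
Definition storage_code : code K a b m := Code
  (fun j f => if [pick v | name v == j] is Some v then encC (v, cv v (encF f)) else dC)
  (fun h _ c => let: (v, y) := decC c in
     if [pick X | cv v X == y] is Some X then encM (v, mv v (new_name h) X) else dM)
  (fun h ms => regenerate (new_name h) (last_nodes h) ms)
  (fun h ds => odflt dF [pick f | k - T <= #|agrees (last_nodes h) ds (encF f)|]).

(** The two files share at least [k - (T + T)] downloads, hence at least [k - FT T], and these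
    determine the file. *)
Lemma decode_unique s ds X Y : uniq s -> size s = k ->
  k - T <= #|agrees s ds X| -> k - T <= #|agrees s ds Y| -> X = Y.
Proof.
move=> us ss cX cY; set J := agrees s ds X :&: agrees s ds Y.
have cJ : k - FT T <= #|J|.
  have := cardsUI (agrees s ds X) (agrees s ds Y); rewrite -/J.
  have : #|agrees s ds X :|: agrees s ds Y| <= k by rewrite -[leqRHS]card_ord max_card.
  move: cX cY; move: #|agrees _ _ X| #|agrees _ _ Y| #|J| #|_ :|: _|; lia.
pose ver (i : 'I_k) := (decC (nth dC ds i)).1.
have inj i j : i \in J -> j \in J -> name (ver i) = name (ver j) -> i = j.
  rewrite !inE => /andP[/andP[/eqP ni _] _] /andP[/andP[/eqP nj _] _].
  rewrite /ver ni nj => /eqP; by rewrite nth_uniq ?ss // => /eqP /val_inj.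
apply: (collect (A := [set ver i | i in J])).
- by move=> _ _ /imsetP[i iJ ->] /imsetP[j jJ ->] /inj ->.
- by rewrite card_in_imset // => i j iJ jJ e; apply: inj; rewrite ?e.
- move=> _ /imsetP[i + ->]; rewrite !inE => /andP[/andP[_ /eqP eX] /andP[_ /eqP eY]].
  by rewrite /ver -eX eY.
Qed.

(** The invariant of a run. It holds for controlled nodes too: the adversary alters what they send,
    not what they store. *)
Definition stores (X : F) (j : nat) (c : a.-tuple 'I_K) :=
  exists2 v, name v = j & c = encC (v, cv v X).

Lemma storage_code_run (f : m.-tuple 'I_K) (adv : adversary K a b) :
  adversary_ok T adv -> forall evs act hist st nxt t,
  valid_from k d L act nxt evs -> all (fun j => j < nxt) act ->
  nxt = N + count is_repair hist ->
  (forall j, j < nxt -> stores (encF f) j (st j)) ->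
  run_correct storage_code f adv hist st nxt t evs.
Proof.
move=> advT; elim=> [//|[fl hs|s] evs IH] act hist st nxt t /=.
  case/and5P=> flact uhs /eqP shs hsact /andP[nL val] actn nxtE stP.
  have wE : new_name (rcons hist (Repair fl hs)) = nxt.
    by rewrite /new_name -cats1 count_cat /= addn0 addn1.
  have hsn : all (fun j => j < nxt) hs.
    by apply/allP => j /(allP hsact) /andP[/(allP actn)].
  have lE : last_nodes (rcons hist (Repair fl hs)) = hs by rewrite /last_nodes last_rcons.
  apply: IH val _ _ _.
  - rewrite /= ltnSn /=; apply/allP => j /mem_rem /(allP actn); exact: ltnW.
  - by rewrite -cats1 count_cat nxtE /= addn0 addn1 addnS.
  move=> j; rewrite ltnS leq_eqVlt; case: eqP => [-> _|_ /= /stP //].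
  rewrite wE lE.
  set ms := map _ hs.
  have ctrl := leq_trans (card_controlled (adv_ctrl adv t) uhs shs) (advT t).
  have [|v nv ->] := @regenerateP nxt hs ms nL uhs shs hsn (encF f) _ ctrl.
    move=> i; rewrite inE => /negbTE ictrl.
    have ih : i < size hs by rewrite shs.
    have [v nv stE] := stP _ (allP hsn _ (mem_nth 0 ih)).
    rewrite /fits /claim /ms (nth_map 0) // ictrl stE encCK.
    case: pickP => [X /eqP eX|/(_ (encF f))]; last by rewrite eqxx.
    by rewrite encMK //= nv eqxx /=; apply/eqP/msg_of_content.
  by exists v.
case/and4P=> us /eqP ss sact val actn nxtE stP.
have lE : last_nodes (rcons hist (Collect s)) = s by rewrite /last_nodes last_rcons.
split; last first.
  apply: IH val actn _ stP.
  by rewrite -cats1 count_cat /= !addn0.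
rewrite lE; set ds := map _ s.
have good : k - T <= #|agrees s ds (encF f)|.
  have := leq_trans (card_controlled (adv_ctrl adv t) us ss) (advT t).
  set B := [set i | _] => BT.
  have : ~: B \subset agrees s ds (encF f).
    apply/subsetP => i; rewrite !inE => /negbTE ictrl.
    have ih : i < size s by rewrite ss.
    have [v nv stE] := stP _ (allP actn _ (allP sact _ (mem_nth 0 ih))).
    by rewrite /ds (nth_map 0) // ictrl stE encCK /= nv !eqxx.
  by move/subset_leq_card; rewrite cardsCs setCK card_ord; apply: leq_trans; rewrite leq_sub2l.
case: pickP => [f' good'|/(_ f)] /=; last by rewrite good.
exact: encF_inj (decode_unique us ss good' good).
Qed.

Lemma storage_code_correct : code_correct N k d T L storage_code.
Proof.
move=> f evs val adv advT; apply: storage_code_run val _ _ _ => //.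
- by apply/allP => j; rewrite mem_iota.
- by rewrite addn0.
move=> j jN; rewrite /stores /=; case: pickP => [v /eqP nv|none]; first by exists v.
by have [v nv] := init jN; have := none v; rewrite nv eqxx.
Qed.

End Protocol.

Local Open Scope ring_scope.

(** * Integer coefficients and Gram matrices *)

Definition clear_denominators p q (A : 'M[rat]_(p, q)) : 'M[int]_(p, q) :=
  \matrix_(i, j) (numq (A i j) * \prod_(u : 'I_p * 'I_q | u != (i, j)) denq (A u.1 u.2)).

Lemma clear_denominators_eqmx p q (A : 'M[rat]_(p, q)) :
  (map_mx intr (clear_denominators A) :=: A)%MS.
Proof.
pose c := \prod_(u : 'I_p * 'I_q) denq (A u.1 u.2).
have -> : map_mx intr (clear_denominators A) = c%:~R *: A.
  apply/matrixP => i j; rewrite !mxE.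
  have -> : c = denq (A i j) * \prod_(u : 'I_p * 'I_q | u != (i, j)) denq (A u.1 u.2).
    by rewrite /c (bigD1 (i, j)).
  rewrite !intrM -{3}[A i j]divq_num_den mulrAC; congr (_ * _).
  by rewrite mulrC divfK // intr_eq0 denq_neq0.
by apply: eqmx_scale; rewrite intr_eq0; apply/prodf_neq0 => u _; rewrite denq_neq0.
Qed.

Section KernelForm.
Variables (m : nat) (V : finType).

Lemma space_eq0 p (C : V -> 'M[rat]_(p, m)) (A : {set V}) n (D : 'M[rat]_(m, n)) :
  (forall v, v \in A -> C v *m D = 0) <-> joint_space C A *m D = 0.
Proof.
split=> [H|/sub_kermxP/space_subP H v vA]; last by apply/sub_kermxP/H.
by apply/sub_kermxP/space_subP => v vA; apply/sub_kermxP/H.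
Qed.

Lemma full_space_eq0 p (C : V -> 'M[rat]_(p, m)) (A : {set V}) n (D : 'M[rat]_(m, n)) :
  (m <= \rank (joint_space C A))%N -> (forall v, v \in A -> C v *m D = 0) -> D = 0.
Proof.
move=> full /space_eq0 CD; rewrite -[D]mul1mx.
have : (1%:M <= joint_space C A)%MS by rewrite sub1mx /row_full eqn_leq full rank_leq_row.
by case/submxP => E ->; rewrite -mulmxA CD mulmx0.
Qed.

End KernelForm.

Lemma scaled_mul0 p q n (A : 'M[rat]_(p, q)) (D : 'M[rat]_(q, n)) :
  map_mx intr (clear_denominators A) *m D = 0 <-> A *m D = 0.
Proof.
have e := clear_denominators_eqmx A.
by split=> /sub_kermxP H; apply/sub_kermxP; move: H; rewrite e.
Qed.

Section IntegerSystem.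
Variables (m a b delta kappa W h : nat).
Hypotheses (kd : (kappa <= delta)%N) (ba : (b <= a)%N).
Hypotheses (mk : (m <= cut_bound a b delta kappa)%N) (mh : (m <= h * b)%N).

(** Spans become statements on kernels: when [D] is the difference of two files, [Cq v *m D = 0]
    says that both give the same content. *)
Lemma integer_system : exists (V : finType) (name : V -> nat)
  (C : V -> 'M[int]_(a, m)) (M : V -> nat -> 'M[int]_(b, m)),
  let Cq v := map_mx intr (C v) : 'M[rat]_(a, m) in
  let Mq v w := map_mx intr (M v w) : 'M[rat]_(b, m) in
  [/\ forall w, (w < W)%N -> exists v, name v = w,
      forall v w n (D : 'M_(m, n)), Cq v *m D = 0 -> Mq v w *m D = 0,
      forall (A : {set V}) n (D : 'M_(m, n)), distinct name A -> (kappa <= #|A|)%N ->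
        (forall v, v \in A -> Cq v *m D = 0) -> D = 0,
      forall w (E : {set V}) n (D : 'M_(m, n)), (w < W)%N -> distinct name E ->
        (h <= #|E|)%N -> (forall v, v \in E -> name v < w)%N ->
        (forall v, v \in E -> Mq v w *m D = 0) -> D = 0 &
      forall w (I : {set V}), (w < W)%N -> distinct name I -> #|I| = delta ->
        (forall v, v \in I -> name v < w)%N ->
        exists2 v, name v = w & forall n (D : 'M_(m, n)),
          (forall u, u \in I -> Mq u w *m D = 0) -> Cq v *m D = 0].
Proof.
have [V [name [C [M [sn sc sm sh si sr]]]]] := repair_system_exists kd ba mk W.
exists V, name, (fun v => clear_denominators (C v)),
  (fun v w => clear_denominators (M v w)) => /=; split => //.
- move=> v w n D /scaled_mul0 CD; apply/scaled_mul0.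
  by have /submxP[E ->] := sm v w; rewrite -mulmxA CD mulmx0.
- move=> A n D dA cA CD; apply: (@full_space_eq0 _ _ _ C A).
    have := sc _ dA; have := leq_trans mk (cut_bound_mono _ _ _ cA); lia.
  by move=> v /CD/scaled_mul0.
- move=> w E n D wW dE cE Ew MD; apply: (@full_space_eq0 _ _ _ (M^~ w) E).
    have := sh _ _ wW dE Ew; have : (h * b <= #|E| * b)%N by rewrite leq_mul2r cE orbT.
    lia.
  by move=> v /MD/scaled_mul0.
- move=> w I wW dI cI Iw; have [v nv /submxP[E Cv]] := sr _ _ wW dI cI Iw.
  exists v => // n D MD; apply/scaled_mul0; rewrite Cv -mulmxA.
  have /space_eq0 -> : forall u, u \in I -> M u w *m D = 0 by move=> u /MD/scaled_mul0.
  by rewrite mulmx0.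
Qed.

End IntegerSystem.

Lemma injection_of_card (A B : finType) : (#|A| <= #|B|)%N -> exists f : A -> B, injective f.
Proof.
move=> AB; exists (fun x => enum_val (widen_ord AB (enum_rank x))) => x y.
by move=> /enum_val_inj/(congr1 val)/= /val_inj /enum_rank_inj.
Qed.

(** * Files as bounded integer matrices *)

Section Polytope.
Variables (m B l : nat).

Definition file_mx (X : 'M['I_B]_(m, l)) : 'M[rat]_(m, l) :=
  map_mx (fun x : 'I_B => (x : nat)%:R) X.

Lemma file_mx_inj : injective file_mx.
Proof.
move=> X Y /matrixP e; apply/matrixP => i j; have := e i j; rewrite !mxE => /eqP.
by rewrite eqr_nat => /eqP /val_inj.
Qed.

(** The shift makes room for negative values: coefficient rows of absolute sum at most [D] give
    entries of absolute value at most [D * B]. *)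
Definition decode_mx D p (Y : 'M['I_(D.*2.+1 * B)]_(p, l)) : 'M[rat]_(p, l) :=
  map_mx (fun y : 'I__ => (y : nat)%:R - (D * B)%:R) Y.

Lemma decode_mxP D p (C : 'M[int]_(p, m)) (X : 'M['I_B]_(m, l)) : (0 < B)%N ->
  (forall i, \sum_u `|C i u| <= D%:Z) ->
  exists Y, decode_mx (D := D) Y = map_mx intr C *m file_mx X.
Proof.
move=> B0 CD; pose XZ : 'M[int]_(m, l) := map_mx (fun x : 'I_B => (x : nat)%:Z) X.
have -> : map_mx intr C *m file_mx X = map_mx intr (C *m XZ) :> 'M[rat]_(p, l).
  rewrite map_mxM; congr (_ *m _); apply/matrixP => i j; by rewrite !mxE.
have bnd i j : `|(C *m XZ) i j| <= (D * B)%:Z.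
  rewrite mxE; apply: le_trans (ler_norm_sum _ _ _) _.
  apply: (@le_trans _ _ (\sum_u `|C i u| * B%:Z)).
    apply: ler_sum => u _; rewrite normrM ler_wpM2l // mxE ger0_norm // lez_nat ltnW //.
  by rewrite -mulr_suml PoszM ler_wpM2r.
have ltB i j : (`|((C *m XZ) i j + (D * B)%:Z)%R| < D.*2.+1 * B)%N.
  have := bnd i j; nia.
exists (\matrix_(i, j) Ordinal (ltB i j)); apply/matrixP => i j; rewrite !mxE /=.
have ge0 : 0 <= (C *m XZ) i j + (D * B)%:Z by have := bnd i j; lia.
rewrite [RHS]mxE; move: ((C *m XZ) i j) ge0 => z ge0.
by rewrite natr_absz ger0_norm // intrD addrK.
Qed.

End Polytope.

Lemma leq_doubleFT T : (T + T <= FT T)%N.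
Proof.
have : (T - 1 <= (T * T) %/ 4)%N by rewrite leq_divRL //; nia.
rewrite /FT; lia.
Qed.

Lemma large_fiber (A C : finType) (g : A -> C) (c0 : C) n :
  (#|C| * n <= #|A|)%N -> exists c, (n <= #|[set x | g x == c]|)%N.
Proof.
move=> CnA; apply/existsP; apply: contraTT CnA => /existsPn small; rewrite -ltnNge.
case: n small => [|n] small; first by have := small c0.
rewrite -sum1_card (partition_big g predT) //=.
apply: leq_ltn_trans (_ : \sum_(c : C) n < _)%N.
  apply: leq_sum => c _; rewrite sum1_card; have := small c; rewrite -ltnNge ltnS.
  by apply: leq_trans; apply/eq_leq/eq_card => x; rewrite !inE.
by rewrite sum_nat_const ltn_pmul2l //; apply/card_gt0P; exists c0.
Qed.

Section Gram.
Variables (m B l : nat).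

(** The entries are at most [l * (B * B)], so [inord] loses nothing. *)
Definition gram (X : 'M['I_B]_(m, l)) : 'M['I_((l * (B * B)).+1)]_m :=
  \matrix_(i, j) inord (\sum_u X i u * X j u)%N.

Lemma gram_file (X Y : 'M['I_B]_(m, l)) : gram X = gram Y ->
  file_mx X *m (file_mx X)^T = file_mx Y *m (file_mx Y)^T.
Proof.
have bnd (Z : 'M['I_B]_(m, l)) i j : (\sum_u Z i u * Z j u <= l * (B * B))%N.
  apply: leq_trans (_ : (\sum_(u < l) B * B <= _)%N); last by rewrite sum_nat_const card_ord.
  by apply: leq_sum => u _; apply: leq_mul; apply: ltnW.
have entry (Z : 'M['I_B]_(m, l)) i j :
    (file_mx Z *m (file_mx Z)^T) i j = (\sum_u Z i u * Z j u)%N%:R.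
  by rewrite mxE natr_sum; apply: eq_bigr => u _; rewrite !mxE natrM.
move=> /matrixP e; apply/matrixP => i j; rewrite !entry; congr (_%:R).
by have := congr1 (@nat_of_ord _) (e i j); rewrite !mxE !inordK ?ltnS.
Qed.

End Gram.

Lemma mulmx_tr_eq0 p q (A : 'M[rat]_(p, q)) : A *m A^T = 0 -> A = 0.
Proof.
move=> /matrixP e; apply/matrixP => i j; apply/eqP; rewrite mxE -sqrf_eq0.
have := e i i; rewrite !mxE => /eqP; rewrite psumr_eq0 => [/allP/(_ j)|u _].
  by rewrite mem_index_enum !mxE => /(_ isT); rewrite -expr2.
by rewrite mxE -expr2 sqr_ge0.
Qed.

(* A forged packet having the prescribed inner products with honest packets that
   span everything has the right projection on the row space of the file, hence
   differs from the true packet by a vector of norm zero. *)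
Lemma forgery_detected (I : finType) (H : {set I}) m l p q (M : 'M[rat]_(p, m))
  (Mh : I -> 'M[rat]_(q, m)) (X : 'M[rat]_(m, l)) (Xh : I -> 'M[rat]_(m, l))
  (Y : 'M[rat]_(p, l)) :
  (0 < #|H|)%N -> (forall n (D : 'M_(m, n)), (forall u, u \in H -> Mh u *m D = 0) -> D = 0) ->
  (forall u, u \in H -> Xh u *m (Xh u)^T = X *m X^T) ->
  (forall u, u \in H -> Y = M *m Xh u) -> (forall u, u \in H -> Mh u *m X = Mh u *m Xh u) ->
  Y = M *m X.
Proof.
move=> /card_gt0P[u0 u0H] full Xg YM MX.
have YX : Y *m X^T = M *m (X *m X^T).
  suff /(congr1 trmx) : X *m (Y - M *m X)^T = 0.
    rewrite trmx0 trmx_mul trmxK mulmxBl => /subr0_eq ->; by rewrite mulmxA.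
  apply: full => u uH; rewrite mulmxA linearB /= mulmxBr.
  (* The product can be computed inside the file [Xh u], where [Y] is a genuine packet and the Gram
     matrix is that of [X]. *)
  have -> : Mh u *m X *m Y^T = Mh u *m (Xh u *m (Xh u)^T) *m M^T.
    by rewrite MX // (YM u uH) trmx_mul !mulmxA.
  by rewrite Xg // trmx_mul !mulmxA subrr.
have YY : Y *m Y^T = M *m (X *m X^T) *m M^T.
  by rewrite -(Xg u0 u0H) (YM u0 u0H) trmx_mul !mulmxA.
have XY : X *m Y^T = X *m X^T *m M^T.
  by have /(congr1 trmx) := YX; rewrite !trmx_mul !trmxK.
apply/subr0_eq/mulmx_tr_eq0.
rewrite linearB /= mulmxBr !mulmxBl YY -[M *m X *m Y^T]mulmxA XY trmx_mul.
by rewrite [Y *m _]mulmxA YX !mulmxA !subrr.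
Qed.

(** * Code lengths and rates *)

Lemma int_mx_row_bound (I : finType) p q (C : I -> 'M[int]_(p, q)) :
  exists D : nat, forall v i, \sum_u `|C v i u| <= D%:Z.
Proof.
exists (\sum_v \sum_i \sum_u `|C v i u|)%N => v i.
rewrite (_ : \sum_u _ = (\sum_u `|C v i u|)%N%:Z); last first.
  by rewrite (big_morph Posz PoszD (erefl _)); apply: eq_bigr => u _; rewrite abszE.
by rewrite lez_nat (bigD1 v) //= (bigD1 i) //= -addnA leq_addr.
Qed.

(** One of the [c] digits per symbol pays for the version, since [#|V| <= l <= K ^ (p * l)]; the
    other [c.-1] pay for the factor [v0.*2.+1]. *)
Lemma mx_code_injection K v0 c s l p (V : finType) (Z := (v0.*2.+1 * K ^ s)%N) :
  (1 < K)%N -> (0 < p)%N -> (v0.*2.+1 < c)%N -> (#|V| <= l)%N ->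
  exists f : V * 'M['I_Z]_(p, l) -> (p * (l * (s + c))).-tuple 'I_K, injective f.
Proof.
move=> K1 p0 vc Vl; apply: injection_of_card.
rewrite card_prod card_mx card_tuple !card_ord /Z.
have Vb : (#|V| <= K ^ (p * l))%N.
  by rewrite (leq_trans Vl) // (leq_trans _ (ltnW (ltn_expl _ K1))) // leq_pmull.
have Zb : (v0.*2.+1 * K ^ s <= K ^ (c.-1 + s))%N.
  rewrite expnD leq_mul2r; apply/orP; right.
  by rewrite (leq_trans _ (ltnW (ltn_expl _ K1))) //; lia.
apply: leq_trans (leq_mul Vb (_ : _ <= K ^ ((c.-1 + s) * (p * l)))%N) _.
  rewrite [leqRHS]expnM; case: (posnP (p * l)) => [->|pl]; first by rewrite !expn0.
  by rewrite leq_exp2r.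
by rewrite -expnD leq_exp2l //; nia.
Qed.

(** [dec] may identify arguments, so [enc] picks any preimage; applying [dec] after inverting [f]
    removes the ambiguity. *)
Lemma encoding_retract (V A B : finType) (Y : eqType) (f : V * A -> B) (dec : A -> Y)
  (b0 : B) (p0 : V * Y) : injective f ->
  exists (enc : V * Y -> B) (unenc : B -> V * Y),
    forall v x, unenc (enc (v, dec x)) = (v, dec x).
Proof.
move=> f_inj.
exists (fun p => if [pick x | dec x == p.2] is Some x then f (p.1, x) else b0).
exists (fun t => if [pick p | f p == t] is Some p then (p.1, dec p.2) else p0).
move=> v x /=; case: (pickP (fun y => dec y == dec x)) => [y /eqP e|/(_ x)]; last by rewrite eqxx.
case: pickP => [p /eqP/f_inj -> /=|/(_ (v, y))]; by rewrite ?e ?eqxx.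
Qed.

(* The [c] extra digits per symbol absorb the growth of the coefficients and the
   version; fixing the Gram matrix costs the [2 * m0] digits missing from the file. *)
Lemma polytope_code (K N k d T L a0 b0 m0 : nat) :
  (1 < K)%N -> (0 < b0 <= a0)%N -> (FT T < k <= d)%N ->
  (m0 <= cut_bound a0 b0 (d - FT T) (k - FT T))%N -> (m0 <= (d - T) * b0)%N ->
  exists c, forall s, (2 * m0 <= s)%N -> exists2 l, (0 < l)%N &
    exists cd : code K (a0 * (l * (s + c))) (b0 * (l * (s + c))) (m0 * (l * (s - 2 * m0))),
      code_correct N k d T L cd.
Proof.
move=> K1 /andP[b00 ba] /andP[Fk kd] mcut mh.
have a00 := leq_trans b00 ba; have K0 := ltnW K1.
(* [N + L] accounts for initial and new nodes; the successor makes [V] nonempty, which supplies the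
   default version [v0]. *)
have [V [name [C [M [init msg collect helpers repair]]]]] :=
  integer_system (N + L).+1 (leq_sub2r (FT T) kd) ba mcut mh.
have [v0 _] : exists v0 : V, name v0 = 0%N by apply: init.
have [D1 CD] := int_mx_row_bound C.
have [D2 MD] := int_mx_row_bound (fun u : V * 'I_L => M u.1 u.2).
pose D := maxn D1 D2; exists D.*2.+2 => s ms.
(* [l >= #|V|] pays for the version, and [l >= 2 * s] leaves each Gram entry at most [K ^ (2 * l)]
   values. *)
pose l := (#|V| + 2 * s).+1; exists l => //.
pose B := (K ^ s)%N; have B0 : (0 < B)%N by rewrite expn_gt0 K0.
(* There are [K ^ (m0 * (l * s))] matrices and at most [K ^ (2 * l * (m0 * m0))] Gram matrices; the
   quotient is the size requested. *)
have [|g fib] := @large_fiber _ _ (@gram m0 B l) (const_mx ord0) (K ^ (m0 * (l * (s - 2 * m0)))).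
  rewrite !card_mx !card_ord.
  have gB : ((l * (B * B)).+1 <= K ^ (2 * l))%N.
    apply: leq_trans (_ : (l.+1 * (B * B) <= _)%N).
      by rewrite mulSn; have := muln_gt0 B B; rewrite B0; lia.
    apply: leq_trans (_ : (K ^ l * (B * B) <= _)%N); first by rewrite leq_mul2r ltn_expl ?orbT.
    by rewrite -!expnD leq_exp2l // /l; lia.
  apply: leq_trans (_ : (K ^ (2 * l * (m0 * m0)) * K ^ (m0 * (l * (s - 2 * m0))) <= _)%N).
    rewrite leq_mul2r [leqRHS]expnM; apply/orP; right.
    by case: (m0) => // m1; rewrite leq_exp2r.
  rewrite -expnD -expnM leq_exp2l //.
  move: ms; set x := (s - _)%N => ms; have -> : s = (2 * m0 + x)%N by rewrite /x; lia.
  nia.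
pose F : finType := {X : 'M['I_B]_(m0, l) | gram X == g}.
have [encF encF_inj] : exists f : (m0 * (l * (s - 2 * m0))).-tuple 'I_K -> F, injective f.
  apply: injection_of_card; rewrite card_tuple card_ord card_sig (leq_trans fib) //.
  by apply/eq_leq/eq_card => X; rewrite !inE.
have [fC fC_inj] := @mx_code_injection K D D.*2.+2 s l a0 V K1 a00 (ltnSn _) (leqW (leq_addr _ _)).
have [fM fM_inj] := @mx_code_injection K D D.*2.+2 s l b0 V K1 b00 (ltnSn _) (leqW (leq_addr _ _)).
pose cv v (X : F) := map_mx intr (C v) *m file_mx (val X) : 'M[rat]__.
pose mv v w (X : F) := map_mx intr (M v w) *m file_mx (val X) : 'M[rat]__.
pose deft n := [tuple of nseq n (Ordinal K0)].
have [encC [decC encCK]] := encoding_retract (@decode_mx B l D a0) (deft _) (v0, 0) fC_inj.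
have [encM [decM encMK]] := encoding_retract (@decode_mx B l D b0) (deft _) (v0, 0) fM_inj.
have diff0 n (A : 'M[rat]_(n, m0)) (X Y : F) :
    A *m file_mx (val X) = A *m file_mx (val Y) <->
    A *m (file_mx (val X) - file_mx (val Y)) = 0.
  by rewrite mulmxBr; split=> [->|/subr0_eq //]; rewrite subrr.
exists (storage_code N k d T name cv mv encF encC decC encM decM (deft _) (deft _) (deft _)).
have TF := leq_doubleFT T.
apply: storage_code_correct => //.
- lia.
- move=> v X; have [Y <-] : exists Y, @decode_mx B l D a0 Y = cv v X; last exact: encCK.
  by apply: decode_mxP => // i; apply: le_trans (CD v i) _; rewrite lez_nat leq_maxl.
- move=> v w X wL.
  have [Y <-] : exists Y, @decode_mx B l D b0 Y = mv v w X; last exact: encMK.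
  apply: decode_mxP => // i; apply: le_trans (MD (v, Ordinal wL) i) _.
  by rewrite lez_nat leq_maxr.
- by move=> w wN; apply: init; lia.
- by move=> v w X Y /diff0 /msg e; apply/diff0.
- move=> A X Y dA cA e; apply/val_inj/file_mx_inj/subr0_eq.
  by apply: (collect A) => // v vA; apply/diff0/e.
- move=> w I wL dI cI Iw; have [|v nv det] := repair w I _ dI cI Iw; first lia.
  by exists v => // X Y e; apply/diff0/det => u uI; apply/diff0/e.
- move=> w H v y X wL dH cH Hw agree.
  have wW : (w < (N + L).+1)%N by lia.
  have ex u : exists Y : F, u \in H -> y = mv v w Y /\ mv u w X = mv u w Y.
    by case: (boolP (u \in H)) => [/agree[Y]|_]; [exists Y|exists X].
  have [Xh XhP] := fin_all_exists ex.
  apply: (@forgery_detected _ H _ _ _ _ _ (fun u => map_mx intr (M u w)) _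
    (fun u => file_mx (val (Xh u)))).
  + by apply: leq_trans cH; lia.
  + by move=> n E; apply: helpers.
  + by move=> u _; apply: gram_file; rewrite (eqP (valP X)) (eqP (valP (Xh u))).
  + by move=> u /XhP[].
  + by move=> u /XhP[].
Qed.

(** This serves the degenerate cases with a single file: an alphabet of one letter, and files of
    length 0. *)
Lemma trivial_code (K N k d T L a b m : nat) : (0 < K)%N ->
  (forall f g : m.-tuple 'I_K, f = g) ->
  exists cd : code K a b m, code_correct N k d T L cd.
Proof.
move=> K0 fg; pose deft n := [tuple of nseq n (Ordinal K0)].
exists (Code (fun _ _ => deft a) (fun _ _ _ => deft b) (fun _ _ => deft a) (fun _ _ => deft m)).
set cd := Code _ _ _ _; move=> f evs _ adv _.
suff run : forall hist st nxt t, run_correct cd f adv hist st nxt t evs by apply: run.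
elim: evs => [//|[fl hs|s] evs IH] hist st nxt t; first exact: IH.
by split; [exact: fg | exact: IH].
Qed.

Lemma common_denominator (alpha beta : rat) : 0 < beta -> beta <= alpha ->
  exists n a b : nat, [/\ (0 < n)%N, (0 < b <= a)%N, n%:R * alpha = a%:R & n%:R * beta = b%:R].
Proof.
move=> beta0 ba; have alpha0 := lt_le_trans beta0 ba.
have nat_mul (x : rat) : 0 < x -> `|denq x|%:R * x = `|numq x|%:R.
  move=> x0; rewrite !natr_absz !gtr0_norm ?denq_gt0 ?numq_gt0 //.
  by rewrite -{2}[x]divq_num_den mulrC divfK // intr_eq0 denq_neq0.
pose n := (`|denq alpha| * `|denq beta|)%N.
have n0 : (0 < n)%N by rewrite muln_gt0 !absz_gt0 !denq_neq0.
exists n, (`|denq beta| * `|numq alpha|)%N, (`|denq alpha| * `|numq beta|)%N.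
have ea : n%:R * alpha = (`|denq beta| * `|numq alpha|)%N%:R :> rat.
  by rewrite /n mulnC natrM -mulrA nat_mul // natrM.
have eb : n%:R * beta = (`|denq alpha| * `|numq beta|)%N%:R :> rat.
  by rewrite /n natrM -mulrA nat_mul // natrM.
split=> //; rewrite -(@ltr_nat rat) -(@ler_nat rat) -ea -eb.
by rewrite mulr_gt0 ?ltr0n //= ler_pM2l ?ltr0n.
Qed.

Lemma natr_minn (x y : nat) : (minn x y)%:R = Num.min x%:R y%:R :> rat.
Proof.
by case: (leqP x y) => xy; [rewrite min_l ?ler_nat | rewrite min_r ?ler_nat // ltnW].
Qed.

Lemma lower_bound_scaled (k d T n a b : nat) (alpha beta : rat) :
  (FT T < k <= d)%N -> n%:R * alpha = a%:R -> n%:R * beta = b%:R ->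
  n%:R * lower_bound k d T alpha beta =
    (minn (cut_bound a b (d - FT T) (k - FT T)) ((d - T) * b))%:R.
Proof.
move=> /andP[Fk kd] ea eb; have TF := leq_doubleFT T.
rewrite /lower_bound minr_pMr // natr_minn; congr (Num.min _ _); last first.
  by rewrite mulrCA eb natrM natrB //; lia.
rewrite mulr_sumr big_mkord /cut_bound natr_sum; apply: eq_bigr => i _.
rewrite minr_pMr // ea minC natr_minn; congr (Num.min _ _).
have := ltn_ord i => ik.
by rewrite mulrCA eb natrM !natrB //; lia.
Qed.

Theorem theorem4 (K N k d T L : nat) (alpha beta : rat) :
  (0 < K)%N -> 0 < beta -> beta <= alpha -> (k <= d)%N ->
  capacity_ge K N k d T L alpha beta (lower_bound k d T alpha beta).
Proof.
move=> K0 beta0 ba kd r rlt.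
have [n [a [b [n0 /andP[b0 ab] ea eb]]]] := common_denominator beta0 ba.
have [K1|K1] := leqP K 1.
  (* With one letter all files coincide and every natural number is an achievable rate; this one is
     at least [r]. *)
  exists `|numq r|%:R; split; last first.
    rewrite -[leLHS]divq_num_den ler_pdivrMr ?ltr0z ?denq_gt0 //.
    rewrite natr_absz -intrM ler_int; have := denq_gt0 r.
    by move: (numq r) (denq r) => x y; nia.
  exists n, a, b, (n * `|numq r|)%N; split; rewrite ?natrM //.
  apply: trivial_code => // f g; apply: eq_from_tnth => i; apply/val_inj => /=.
  by case: (tnth f i) (tnth g i) => x xK [y yK] /=; lia.
have [lb0|lb0] := lerP (lower_bound k d T alpha beta) 0.
  exists 0; split; last exact: ltW (lt_le_trans rlt lb0).
  exists n, a, b, 0%N; split; rewrite ?mulr0 //.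
  by apply: trivial_code => // f g; rewrite [f]tuple0 [g]tuple0.
have Fk : (FT T < k)%N.
  rewrite ltnNge; apply/negP => kF; move: lb0.
  by rewrite /lower_bound big_geq ?lt_min ?ltxx // leqn0 subn_eq0.
have Fkd : (FT T < k <= d)%N by rewrite Fk kd.
have scaled := lower_bound_scaled Fkd ea eb.
set m := minn _ _ in scaled.
have m0 : (0 < m)%N by rewrite -(@ltr_nat rat) -scaled mulr_gt0 ?ltr0n.
have [|c codes] := @polytope_code K N k d T L a b m K1 _ Fkd (geq_minl _ _) (geq_minr _ _).
  by rewrite b0 ab.
have rm : 0 < m%:R - n%:R * r by rewrite subr_gt0 -scaled ltr_pM2l ?ltr0n.
(* With [s = 2 * m + t] the rate is [m * t / (n * (2 * m + t + c))]; it reaches [r] exactly when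
   [n * r * (2 * m + c) <= (m - n * r) * t], so any [t] above [x] will do. *)
pose x := `|n%:R * r * (2 * m + c)%:R| / (m%:R - n%:R * r).
pose t := Num.bound x.
have xt : x < t%:R by apply: archi_boundP; rewrite divr_ge0 // ltW.
have [l l0 code_ok] := codes (2 * m + t)%N (leq_addr _ _).
pose u := (l * (2 * m + t + c))%N.
have nu0 : 0 < (n * u)%:R :> rat by rewrite ltr0n !muln_gt0 n0 l0 addn_gt0 addn_gt0 muln_gt0 m0.
exists ((m * (l * t))%:R / (n * u)%:R); split; last first.
  rewrite ler_pdivlMr //.
  have -> : r * (n * u)%:R = l%:R * (n%:R * r * (2 * m + c)%:R + n%:R * r * t%:R).
    by rewrite /u !(natrM, natrD); ring.
  rewrite !natrM mulrCA ler_wpM2l // -lerBrDr -mulrBl [leRHS]mulrC -ler_pdivrMr //.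
  by apply: le_trans (ltW xt); rewrite ler_pM2r ?invr_gt0 // ler_norm.
exists (n * u)%N, (a * u)%N, (b * u)%N, (m * (l * t))%N; split.
- by move: nu0; rewrite ltr0n.
- by rewrite !natrM mulrAC ea.
- by rewrite !natrM mulrAC eb.
- by rewrite mulrC divfK // gt_eqF.
by move: code_ok; rewrite addKn.
Qed.
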